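(* Let $n$ be even and let $j$ be a positive integer with $\eta := j/n \leq 1/10$. Let $H = J(n,n/2,j)$, let $A$ be its adjacency matrix, let $d = {n/2 \choose j}^2$ (the degree of the regular graph $H$), and let $\tilde{L} = I - A/d$ be the normalised Laplacian of $H$, where $I$ is the ${n \choose n/2}\times{n \choose n/2}$ identity matrix. Let $\tilde{\mu}_1 \leq \tilde{\mu}_2 \leq \dots \leq \tilde{\mu}_{{n \choose n/2}}$ be the eigenvalues of $\tilde{L}$ in increasing order, counted with multiplicity (so $\tilde{\mu}_1 = 0$). Then $$\tilde{\mu}_2 \geq \eta/2.$$
   Context: For $1 \leq j \leq k \leq n$, the Johnson graph $J(n,k,j)$ has vertex set ${[n] \choose k}$ (the $k$-element subsets of $[n]=\{1,\dots,n\}$), with two $k$-sets joined by an edge iff their symmetric difference has size $2j$. *)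

(* Defs.v *)
From HB Require Import structures.
From mathcomp Require Import all_boot all_order all_algebra.
From mathcomp Require Import reals.
Set Implicit Arguments. Unset Strict Implicit. Unset Printing Implicit Defensive.
Import Order.TTheory GRing.Theory Num.Theory.
Local Open Scope ring_scope.

Definition ksets (n k : nat) : {set {set 'I_n}} := [set A : {set 'I_n} | #|A| == k].

Definition symdiff (T : finType) (A B : {set T}) : {set T} := (A :\: B) :|: (B :\: A).

Definition johnson_adj (R : nzRingType) (n k j : nat) : 'M[R]_#|ksets n k| :=
  \matrix_(a, b) (if #|symdiff (enum_val a) (enum_val b)| == (2 * j)%N then 1 else 0).

Definition norm_laplacian (R : fieldType) (n k j : nat) (d : R) : 'M[R]_#|ksets n k| :=
  1%:M - d^-1 *: johnson_adj R n k j.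

Definition sorted_eigenvalues (R : numFieldType) (m : nat) (M : 'M[R]_m) (s : seq R) : Prop :=
  sorted <=%R s /\ char_poly M = \prod_(x <- s) ('X - x%:P).

(* Main.v *)
(** Path coupling.  Let [f] be an eigenfunction of the adjacency operator with
    eigenvalue [lam], and let [(A, x, y)] maximise [|f A - f A'|], where [A'] is
    the image of [A] under the transposition [(x y)].  Transporting the sum
    over the neighbours of [A'] to the neighbours [B] of [A] along [(x y)], the
    terms in which [B] contains both or neither of [x], [y] cancel, so
    [lam * |f A - f A'| <= N * |f A - f A'|], where [N] counts the
    neighbours of [A] separating [x] from [y].  Hence [f] is constant as
    soon as [lam > N].  For [k = n/2] and [p = 2j/n],
    [N / d = (1 - p)^2 + p^2 <= 1 - (8/5) p < 1 - eta/2], so at most one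
    eigenvalue of the Laplacian, counted with multiplicity, lies below
    [eta/2]. *)
Require Import Defs.
From HB Require Import structures.
From mathcomp Require Import all_boot all_order all_algebra.
From mathcomp Require Import reals.
From mathcomp Require Import perm spectral complex zify ring lra.
Set Implicit Arguments. Unset Strict Implicit. Unset Printing Implicit Defensive.
Import Order.TTheory GRing.Theory Num.Theory.
Local Open Scope ring_scope.

(** * Spectra of real symmetric matrices *)

(** Over [R[i]] the matrix is hermitian, so it is unitarily diagonalizable with real spectrum; real
    matrices similar over [R[i]] are similar over [R]. *)
Lemma symmetric_diagonalizable (R : rcfType) (n : nat) (M : 'M[R]_n) :
  M^T = M ->
  exists2 P : 'M[R]_n, P \in unitmx &
    exists D : 'rV[R]_n, P *m M = diag_mx D *m P.
Proof.
move=> symM; pose toC := real_complex R; pose MC := map_mx toC M.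
have realMC : MC \is a mxOver Num.real.
  by apply/mxOverP => i k; rewrite mxE; apply/complex_realP; eexists.
have hermMC : MC \is hermsymmx.
  apply: realsym_hermsym => //; apply/is_hermitianmxP.
  by rewrite expr0 scale1r map_mx_id // map_trmx symM.
have /mxOverP realD := hermitian_spectral_diag_real hermMC.
have /orthomx_spectralP eqMC := hermitian_normalmx hermMC.
set P := spectralmx MC in eqMC; set D := spectral_diag MC in eqMC realD.
have Punit : P \in unitmx := spectral_unit MC.
have [] := @real_similar _ _ MC (diag_mx D).
- exists P => //; apply/similarP => //.
  by rewrite [in LHS]eqMC !mulmxA mulmxV // mul1mx.
- exact: realMC.
- apply/mxOverP => i k; rewrite mxE.
  by case: (i == k); rewrite ?mulr1n ?mulr0n ?real0 ?realD.
move=> Q /andP[/mxOverP realQ Qunit] /(similarP Qunit) eqQ.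
pose reals m p (X : 'M[R[i]]_(m, p)) := map_mx (@complex.Re R) X.
have toCK m p (X : 'M[R[i]]_(m, p)) : (forall i k, X i k \is Num.real) ->
    map_mx toC (reals _ _ X) = X.
  by move=> realX; apply/matrixP => i k; rewrite !mxE /toC RRe_real.
exists (reals _ _ Q); first by rewrite -(map_unitmx toC) toCK.
exists (reals _ _ D); apply: (@map_mx_inj _ _ toC).
by rewrite !map_mxM map_diag_mx !toCK.
Qed.

Lemma char_poly_diagonalized (R : fieldType) (n : nat) (M P : 'M[R]_n)
    (D : 'rV[R]_n) :
  P \in unitmx -> P *m M = diag_mx D *m P ->
  char_poly M = \prod_i ('X - (D 0 i)%:P).
Proof.
move=> Punit diagP; have -> : char_poly M = char_poly (diag_mx D).
  have detP : \det (map_mx polyC P) != 0.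
    by rewrite det_map_mx polyC_eq0 -unitfE -unitmxE.
  apply: (mulfI detP); rewrite [RHS]mulrC /char_poly /char_poly_mx -!det_mulmx.
  by rewrite mulmxBr mulmxBl -!map_mxM diagP scalar_mxC.
rewrite char_poly_trig ?diag_mx_is_trig //.
by apply: eq_bigr => i _; rewrite mxE eqxx mulr1n.
Qed.

(** If two entries of the spectrum were below [b], two rows of the diagonalizing matrix would both
    be multiples of [w], against its invertibility. *)
Lemma second_eigenvalue_ge (R : rcfType) (n : nat) (M : 'M[R]_n) (b : R)
    (w : 'rV[R]_n) :
  M^T = M -> (1 < n)%N ->
  (forall (mu : R) (v : 'rV[R]_n),
     v *m M = mu *: v -> mu < b -> (v <= w)%MS) ->
  exists s : seq R, sorted_eigenvalues M s /\ b <= s`_1.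
Proof.
move=> symM n_gt1 low_eig.
have [P Punit [D diagP]] := symmetric_diagonalizable symM.
pose s := sort <=%R [seq D 0 i | i <- enum 'I_n].
have sorted_s : sorted <=%R s by apply: sort_sorted; apply: le_total.
have perm_s : perm_eq s [seq D 0 i | i <- enum 'I_n] by rewrite perm_sort.
exists s; split; first split => //.
  rewrite (char_poly_diagonalized Punit diagP) (perm_big _ perm_s) /=.
  by rewrite big_map big_enum.
have size_s : size s = n by rewrite (perm_size perm_s) size_map size_enum_ord.
rewrite leNgt; apply/negP => s1_lt.
have : (1 < count (fun x : R => (x < b)%R) s)%N.
  move: size_s s1_lt sorted_s; case: s {perm_s} => [|x [|y s]] /=.
  - by move=> n0; rewrite -n0 in n_gt1.
  - by move=> n1; rewrite -n1 in n_gt1.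
  by move=> _ y_lt /andP[xy _]; rewrite y_lt (le_lt_trans xy y_lt).
rewrite (seq.permP perm_s) count_map -size_filter.
rewrite (_ : size _ = #|[pred i | (D 0 i < b)%R]|); last first.
  by rewrite cardE enumT /enum_mem; congr size; apply: eq_filter => i; rewrite inE.
move=> /card_gt1P[i [k [/= Di Dk ik]]].
have eigP l : row l P *m M = D 0 l *: row l P.
  by rewrite -row_mul diagP row_mul row_diag_mx -scalemxAl -rowE.
have /sub_rVP[a Pi] := low_eig _ _ (eigP i) Di.
have /sub_rVP[c Pk] := low_eig _ _ (eigP k) Dk.
have Pfree : row_free P by rewrite row_free_unit.
(* Both sides are sent by [P] to [(a * c) *: w]. Comparing entries gives [a = 0], so row [i] of [P]
   vanishes. *)
have : a *: delta_mx 0 k = c *: delta_mx 0 i :> 'rV[R]_n.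
  apply: (row_free_inj Pfree).
  by rewrite -!scalemxAl -!rowE Pi Pk !scalerA mulrC.
move=> /matrixP/(_ 0 k); rewrite !mxE !eqxx /= (negPf (_ : k != i)) 1?eq_sym //.
rewrite mulr1 mulr0 => a0.
have : delta_mx 0 i = 0 :> 'rV[R]_n.
  by apply: (row_free_inj Pfree); rewrite mul0mx -rowE Pi a0 scale0r.
by move=> /matrixP/(_ 0 i)/eqP; rewrite !mxE !eqxx oner_eq0.
Qed.

(** * Transpositions acting on sets *)

Definition swap (T : finType) (x y : T) (A : {set T}) := tperm x y @^-1: A.

Lemma in_swap (T : finType) (x y z : T) (A : {set T}) :
  (z \in swap x y A) = (tperm x y z \in A).
Proof. by rewrite inE. Qed.

Lemma swapK (T : finType) (x y : T) : involutive (swap x y).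
Proof. by move=> A; apply/setP => z; rewrite !in_swap tpermK. Qed.

Lemma card_swap (T : finType) (x y : T) (A : {set T}) : #|swap x y A| = #|A|.
Proof. by rewrite /swap card_preimset //; apply: perm_inj. Qed.

Lemma card_symdiff_swap (T : finType) (x y : T) (A B : {set T}) :
  #|symdiff (swap x y A) (swap x y B)| = #|symdiff A B|.
Proof.
by rewrite -[RHS](card_swap x y); apply: eq_card => z; rewrite !inE.
Qed.

Lemma swap_id (T : finType) (x y : T) (A : {set T}) :
  (x \in A) = (y \in A) -> swap x y A = A.
Proof.
by move=> xyA; apply/setP => z; rewrite in_swap; case: tpermP => // ->.
Qed.

Lemma symdiffC (T : finType) (A B : {set T}) : symdiff A B = symdiff B A.
Proof. by rewrite /symdiff setUC. Qed.

(** * Counting the neighbours that separate two points *)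

Lemma cards_symdiff (T : finType) (A B : {set T}) (j : nat) :
  #|B| = #|A| -> #|symdiff A B| = (2 * j)%N ->
  #|A :\: B| = j /\ #|B :\: A| = j.
Proof.
move=> eqAB; rewrite /symdiff cardsU.
rewrite (_ : _ :&: _ = set0) ?cards0; last first.
  by apply/setP => z; rewrite !inE; case: (z \in A); case: (z \in B).
have := cardsID B A; have := cardsID A B; rewrite (setIC B A); lia.
Qed.

(* For [x] in a [k]-set [A] and [y] outside it, the number of neighbours
   [A - U + V] of [A] containing exactly one of [x], [y]: either [x] is not in
   [U] and [y] is not in [V], or both are. *)
Definition johnson_moved (n k j : nat) : nat :=
  'C(k.-1, j) * 'C((n - k).-1, j) +
  ('C(k, j) - 'C(k.-1, j)) * ('C(n - k, j) - 'C((n - k).-1, j)).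

Lemma card_draws_with (T : finType) (A : {set T}) (x : T) (j : nat) :
  x \in A ->
  #|[set U : {set T} | [&& U \subset A, #|U| == j & x \in U]]| =
    ('C(#|A|, j) - 'C(#|A|.-1, j))%N.
Proof.
move=> xA; pose S := [set U : {set T} | U \subset A & #|U| == j].
have <- : #|S| = 'C(#|A|, j) by rewrite cards_draws.
have <- : #|S :\: [set U : {set T} | x \in U]| = 'C(#|A|.-1, j).
  rewrite (cardsD1 x A) xA -cards_draws; apply: eq_card => U.
  by rewrite !inE subsetD1; case: (U \subset A); case: (x \in U).
rewrite -(cardsID [set U : {set T} | x \in U] S) addnK; apply: eq_card => U.
by rewrite !inE -andbA.
Qed.

(** A set [B] is determined by the pair [(A :\: B, B :\: A)]. Separation of [x] and [y] puts this
    pair in [D1 x D2] (neither point moved) or [D3 x D4] (both moved). *)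
Lemma card_moved_le (n k j : nat) (A : {set 'I_n}) (x y : 'I_n) :
  #|A| = k -> x \in A -> y \notin A ->
  (#|[set B : {set 'I_n} | [&& #|B| == k, #|symdiff A B| == (2 * j)%N
      & (x \in B) != (y \in B)]]| <= johnson_moved n k j)%N.
Proof.
move=> cardA xA yA.
have yA' : y \in ~: A by rewrite inE.
have cardAC : #|~: A| = (n - k)%N by rewrite cardsCs setCK card_ord cardA.
pose D1 := [set U : {set 'I_n} | U \subset A :\ x & #|U| == j].
pose D2 := [set U : {set 'I_n} | U \subset ~: A :\ y & #|U| == j].
pose D3 := [set U : {set 'I_n} | [&& U \subset A, #|U| == j & x \in U]].
pose D4 := [set U : {set 'I_n} | [&& U \subset ~: A, #|U| == j & y \in U]].
pose h (B : {set 'I_n}) := (A :\: B, B :\: A).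
have h_inj : injective h.
  move=> B B' [/setP eqL /setP eqR]; apply/setP => z.
  have := eqL z; have := eqR z; rewrite !inE.
  by case: (z \in A); case: (z \in B); case: (z \in B').
have -> : johnson_moved n k j = (#|D1| * #|D2| + #|D3| * #|D4|)%N.
  rewrite /D1 /D2 /D3 /D4 !cards_draws !card_draws_with // cardAC cardA.
  have -> : #|A :\ x| = k.-1 by rewrite -cardA (cardsD1 x A) xA.
  have -> // : #|~: A :\ y| = (n - k).-1.
    by rewrite -cardAC (cardsD1 y (~: A)) yA'.
rewrite -!cardsX -(card_imset _ h_inj).
apply: leq_trans (leq_card_setU _ _); apply: subset_leq_card.
apply/subsetP => p /imsetP[B + ->].
rewrite inE => /and3P[/eqP cardB /eqP dAB xyB].
have [cAB cBA] := cards_symdiff (etrans cardB (esym cardA)) dAB.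
rewrite !inE cAB cBA !eqxx /= !subsetD1 !inE xA yA.
rewrite subsetDl /= setDE subsetIr /=.
by move: xyB; case: (x \in B); case: (y \in B).
Qed.

(** * Eigenfunctions with large eigenvalue are constant *)

(** Exchanging a point of [A :\: B] with one of [B :\: A] shrinks [A :\: B], so transpositions
    connect any two [k]-sets. *)
Lemma swap_invariant_const (T : finType) (R : Type) (k : nat)
    (f : {set T} -> R) :
  (forall (x y : T) (A : {set T}), #|A| = k -> f (swap x y A) = f A) ->
  forall A B : {set T}, #|A| = k -> #|B| = k -> f A = f B.
Proof.
move=> f_swap A B cardA cardB.
have [d] := ubnP #|A :\: B|; elim: d A cardA => // d IHd A cardA ABd.
have [AB0|[x]] := set_0Vmem (A :\: B).
  suff -> : A = B by [].
  by apply/eqP; rewrite eqEcard cardA cardB leqnn andbT -setD_eq0 AB0.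
rewrite inE => /andP[xB xA].
have : (0 < #|B :\: A|)%N.
  have := cardsID A B; have := cardsID B A; have := cardsD1 x (A :\: B).
  by rewrite inE xA xB setIC; lia.
move=> /card_gt0P[y]; rewrite inE => /andP[yA yB].
rewrite -(f_swap x y A cardA); apply: IHd; first by rewrite card_swap.
suff sub : swap x y A :\: B \subset (A :\: B) :\ x.
  have := subset_leq_card sub; have := cardsD1 x (A :\: B).
  by rewrite inE xA xB /=; lia.
apply/subsetP => z; rewrite !inE; case: tpermP => [->|->|].
- by rewrite (negPf yA) andbF.
- by rewrite yB.
- by move=> /eqP -> _ ->.
Qed.

Lemma johnson_eigenfunction_swap (R : realFieldType) (n k j : nat)
    (f : {set 'I_n} -> R) (lam : R) :
  (forall A : {set 'I_n}, #|A| = k ->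
     \sum_(B : {set 'I_n} | (#|B| == k) && (#|symdiff A B| == (2 * j)%N)) f B = lam * f A) ->
  (johnson_moved n k j)%:R < lam ->
  forall (x y : 'I_n) (A : {set 'I_n}), #|A| = k -> f (swap x y A) = f A.
Proof.
move=> f_eig lam_gt x0 y0 A0 cardA0.
pose Q := ({set 'I_n} * ('I_n * 'I_n))%type.
pose g (p : Q) : R := `|f p.1 - f (swap p.2.1 p.2.2 p.1)|.
pose P (p : Q) := #|p.1| == k.
have P0 : P (A0, (x0, y0)) by apply/eqP.
case: (arg_maxP g P0) => -[A [x y]] /eqP /= cardA.
set L := g (A, (x, y)) => maxL.
suff L0 : L = 0.
  have := maxL _ P0; rewrite L0 /g /= => le0; apply/esym/eqP.
  by rewrite -subr_eq0 -normr_le0.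
apply/eqP/negPn/negP => L_neq0.
have L_gt0 : 0 < L by rewrite lt_neqAle eq_sym L_neq0 normr_ge0.
(* Since [L] is nonzero, [A] contains exactly one of [x], [y], and [L] is symmetric in them. *)
wlog xA : x y @L maxL L_neq0 L_gt0 / x \in A.
  move=> wlogxA; have [xA|xA] := boolP (x \in A); first exact: (wlogxA x y).
  have [yA|yA] := boolP (y \in A).
    have eqL : g (A, (y, x)) = L by rewrite /L /g /= /swap tpermC.
    by apply: (wlogxA y x) => //; rewrite eqL.
  move: L_neq0; rewrite /L /g /= swap_id ?subrr ?normr0 ?eqxx //.
  by rewrite (negPf xA) (negPf yA).
have yA : y \notin A.
  apply: contraNN L_neq0 => yA.
  by rewrite /L /g /= swap_id ?subrr ?normr0 ?xA.
have : lam * L <= (johnson_moved n k j)%:R * L.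
  have lam_ge0 : 0 <= lam by apply: le_trans (ltW lam_gt); rewrite ler0n.
  rewrite -{1}(ger0_norm lam_ge0) /L {1}/g /= -normrM mulrBr.
  rewrite -f_eig // -f_eig ?card_swap //.
  (* This pairs each neighbour [B] of [A] with the neighbour [swap x y B] of [swap x y A]. *)
  rewrite [X in _ - X](reindex_inj (inv_inj (swapK x y))) /=.
  under [X in _ - X]eq_bigl => B do rewrite card_swap card_symdiff_swap.
  rewrite -sumrB; apply: le_trans (ler_norm_sum _ _ _) _.
  rewrite (bigID (fun B : {set 'I_n} => (x \in B) == (y \in B))) /= big1 ?add0r.
    apply: (@le_trans _ _ (\sum_(B : {set 'I_n} | (#|B| == k) &&
        (#|symdiff A B| == (2 * j)%N) && ((x \in B) != (y \in B))) L)).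
      apply: ler_sum => B /andP[/andP[cardB _] _].
      exact: (maxL (B, (x, y))).
    rewrite sumr_const -/L -[leLHS]mulr_natl; apply: ler_wpM2r; first exact: ltW.
    rewrite ler_nat; apply: leq_trans (card_moved_le j cardA xA yA).
    by apply/eq_leq/eq_card => B; rewrite !inE andbA.
  by move=> B /andP[_ /eqP xyB]; rewrite swap_id // subrr normr0.
by rewrite leNgt ltr_pM2r // lam_gt.
Qed.

Lemma johnson_eigenvector_const (R : realFieldType) (n k j : nat) (lam : R)
    (v : 'rV[R]_#|ksets n k|) :
  v *m johnson_adj R n k j = lam *: v -> (johnson_moved n k j)%:R < lam ->
  (v <= (const_mx 1 : 'rV[R]_#|ksets n k|))%MS.
Proof.
move=> v_eig lam_gt.
have [->|/rV0Pn[a0 _]] := eqVneq v 0; first exact: sub0mx.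
have A0in := enum_valP a0.
(* [A0in] supplies a default index, so [f] takes a junk value on sets that are not [k]-sets. *)
pose f (A : {set 'I_n}) : R := v 0 (enum_rank_in A0in A).
have fE a : f (enum_val a) = v 0 a by rewrite /f enum_valK_in.
have ks (A : {set 'I_n}) : (A \in ksets n k) = (#|A| == k) by rewrite inE.
have f_eig (A : {set 'I_n}) : #|A| = k ->
   \sum_(B : {set 'I_n} | (#|B| == k) && (#|symdiff A B| == (2 * j)%N)) f B = lam * f A.
  move=> /eqP; rewrite -ks => Ain; rewrite /f.
  move/matrixP: v_eig => /(_ 0 (enum_rank_in A0in A)); rewrite !mxE => <-.
  under eq_bigl => B do rewrite -ks.
  rewrite big_mkcondr big_enum_val; apply: eq_bigr => b _.
  rewrite enum_valK_in mxE enum_rankK_in // symdiffC.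
  by case: eqP => _; rewrite ?mulr1 ?mulr0.
have f_const := swap_invariant_const (johnson_eigenfunction_swap f_eig lam_gt).
apply/sub_rVP; exists (v 0 a0); apply/rowP => a; rewrite !mxE mulr1 -!fE.
by apply: f_const; apply/eqP; rewrite -ks enum_valP.
Qed.

(** * The middle layer and the Laplacian bound *)

Lemma johnson_adj_sym (R : nzRingType) (n k j : nat) :
  (johnson_adj R n k j)^T = johnson_adj R n k j.
Proof. by apply/matrixP => a b; rewrite !mxE symdiffC. Qed.

(** A given point of an [m]-set is avoided by a fraction [1 - j/m] of its [j]-subsets. *)
Lemma bin_pred_fraction (R : numFieldType) (m j : nat) :
  (0 < m)%N -> (j <= m)%N ->
  'C(m.-1, j)%:R = (1 - j%:R / m%:R) * 'C(m, j)%:R :> R.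
Proof.
move=> m_gt0 jm; have m_neq0 : m%:R != 0 :> R by rewrite pnatr_eq0 -lt0n.
apply: (mulfI m_neq0); rewrite -natrM mul_bin_down natrM natrB // mulrA.
by congr (_ * _); field.
Qed.

Lemma johnson_moved_half (R : realFieldType) (n j : nat) (p : R) :
  ~~ odd n -> (0 < n)%N -> (j <= n./2)%N -> p = j%:R / (n./2)%:R ->
  (johnson_moved n n./2 j)%:R =
    ((1 - p) ^+ 2 + p ^+ 2) * ('C(n./2, j) ^ 2)%N%:R :> R.
Proof.
move=> n_even n_gt0 jm pE; have nE : (n - n./2 = n./2)%N by lia.
have m_gt0 : (0 < n./2)%N by lia.
rewrite /johnson_moved nE natrD !natrM natrB ?leq_bin2l ?leq_pred //.
by rewrite bin_pred_fraction // -pE; ring.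
Qed.

Theorem theorem2 (R : realType) (n j : nat) :
  ~~ odd n -> (0 < n)%N -> (0 < j)%N ->
  (j%:R / n%:R : R) <= 1 / 10 ->
  exists s : seq R,
    sorted_eigenvalues (norm_laplacian n (n./2) j (('C(n./2, j) ^ 2)%N%:R)) s /\
    (j%:R / n%:R) / 2 <= s`_1.
Proof.
move=> n_even n_gt0 j_gt0 eta_le.
have n_gt0R : 0 < n%:R :> R by rewrite ltr0n.
have j10 : (10 * j <= n)%N.
  by move: eta_le; rewrite ler_pdivrMr // -(ler_nat R) natrM; lra.
set m := n./2; have jm : (j <= m)%N by rewrite /m; lia.
set d : R := ('C(m, j) ^ 2)%N%:R.
have d_gt0 : 0 < d by rewrite ltr0n expn_gt0 bin_gt0 jm.
have d_neq0 : d != 0 by rewrite gt_eqF.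
pose eta : R := j%:R / n%:R.
have etaE : j%:R / m%:R = 2 * eta.
  have nE : n%:R = 2 * m%:R :> R by rewrite -natrM; congr _%:R; rewrite /m; lia.
  have m_neq0 : m%:R != 0 :> R by rewrite pnatr_eq0 /m; lia.
  by rewrite /eta nE; field.
have eta_gt0 : 0 < eta by rewrite divr_gt0 ?ltr0n.
apply: (@second_eigenvalue_ge _ _ _ _ (const_mx 1)).
- by rewrite linearB linearZ /= trmx1 johnson_adj_sym.
(* Pascal's rule writes ['C(n, m)] as a sum of two positive terms, so it exceeds 1. *)
- rewrite card_draws card_ord -/m.
  have -> : n = n.-1.+1 by lia.
  have -> : m = m.-1.+1 by rewrite /m; lia.
  by rewrite binS -(addn1 1) leq_add // bin_gt0 /m; lia.
move=> mu v v_eig mu_lt.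
(* An eigenvalue [mu] of [1 - A/d] corresponds to the eigenvalue [d * (1 - mu)] of [A]. *)
apply: (@johnson_eigenvector_const _ _ _ j (d * (1 - mu))).
  rewrite -scalerA scalerBl scale1r -v_eig mulmxBr mulmx1 opprB addrC subrK.
  by rewrite -scalemxAr scalerA divff // scale1r.
(* With [p = 2 * eta] it remains to see that [1 - 4 eta + 8 eta^2 < 1 - mu], which follows from
   [mu < eta / 2] and [0 < eta <= 1/10]. *)
rewrite (johnson_moved_half n_even n_gt0 jm (esym etaE)) -/m -/d mulrC.
rewrite ltr_pM2l //; rewrite -/eta in mu_lt eta_le; nra.
Qed.
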